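(* Let $q=p^r$ be a prime power, let $t<q-1$, and let $\mathcal{S}$ be a $t$-semiarc of $V_t^\circ$ type in $\mathrm{PG}(2,q)$. Then: (a) if $\gcd(q,t)=1$ and $\gcd(q-1,t-1)=1$, then $\mathcal{S}$ is a $V_t$-configuration; (b) if $\gcd(q,t)=1$, then $\mathcal{S}$ is contained in a vertexless triangle; (c) if $\gcd(q-1,t)=1$, then $\mathcal{S}$ is contained in a vertexless triangle or in the union of three concurrent lines with their common point removed.
   Context: A non-empty point set $\mathcal{S}$ of a projective plane is a $t$-semiarc if for every point $P\in\mathcal{S}$ there are exactly $t$ lines $\ell$ with $\ell\cap\mathcal{S}=\{P\}$ (tangents at $P$). For two distinct lines $\ell_1,\ell_2$, a $V_t$-configuration is a set obtained from the symmetric difference $\ell_1\triangle\ell_2$ by removing $t$ further points from each of $\ell_1\setminus\ell_2$ and $\ell_2\setminus\ell_1$. $\mathcal{S}$ is of $V_t^\circ$ type if there are two distinct lines $\ell_1,\ell_2$ with $\ell_1\cap\ell_2\notin\mathcal{S}$ such that $(\ell_1\triangle\ell_2)\cap\mathcal{S}$ is a $V_t$-configuration with respect to $\ell_1,\ell_2$. A vertexless triangle is the union of three non-concurrent lines with their three pairwise intersection points removed. *)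

(* Defs.v *)
From HB Require Import structures.
From mathcomp Require Import all_boot all_order all_algebra.

Set Implicit Arguments.
Unset Strict Implicit.
Unset Printing Implicit Defensive.

Local Open Scope ring_scope.

(* A d-dimensional subspace of F^3, encoded by the canonical square matrix     *)
(* whose row space it is; since <<A>> only depends on the row space of A,      *)
(* Leibniz equality of [subspace F d] is equality of subspaces.                *)
Record subspace (F : finFieldType) (d : nat) := Subspace {
  subspace_mx :> 'M[F]_3;
  _ : (<<subspace_mx>>%MS == subspace_mx) && (\rank subspace_mx == d)
}.

HB.instance Definition _ (F : finFieldType) (d : nat) :=
  [isSub for @subspace_mx F d].
HB.instance Definition _ (F : finFieldType) (d : nat) :=
  [Finite of subspace F d by <:].

(* PG(2, #|F|) *)
Notation point F := (subspace F 1).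
Notation line F := (subspace F 2).

Section SemiArcs.

Variable F : finFieldType.
Implicit Types (l : line F) (P : point F) (S A : {set point F}) (t : nat).

Definition pts l : {set point F} := [set P : point F | (P <= l)%MS].

Definition tangents S P : {set line F} := [set l | pts l :&: S == [set P]].

Definition semiarc t S : Prop :=
  S != set0 /\ forall P, P \in S -> #|tangents S P| = t.

Definition symdiff A B : {set point F} := (A :\: B) :|: (B :\: A).

Definition V_config_wrt t l1 l2 A : Prop :=
  exists R1 R2 : {set point F},
    [/\ R1 \subset pts l1 :\: pts l2, #|R1| = t,
        R2 \subset pts l2 :\: pts l1, #|R2| = t
      & A = symdiff (pts l1) (pts l2) :\: (R1 :|: R2)].

Definition V_config t A : Prop :=
  exists l1 l2, l1 != l2 /\ V_config_wrt t l1 l2 A.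

Definition V_circ_type t S : Prop :=
  exists l1 l2,
    [/\ l1 != l2, [disjoint pts l1 :&: pts l2 & S]
      & V_config_wrt t l1 l2 (symdiff (pts l1) (pts l2) :&: S)].

(* Lines with no common point are pairwise distinct, because any two lines of  *)
(* the plane meet.                                                             *)
Definition vertexless_triangle A : Prop :=
  exists l1 l2 l3,
    pts l1 :&: pts l2 :&: pts l3 = set0 /\
    A = (pts l1 :|: pts l2 :|: pts l3) :\:
        ((pts l1 :&: pts l2) :|: (pts l2 :&: pts l3) :|: (pts l1 :&: pts l3)).

Definition punctured_pencil3 A : Prop :=
  exists l1 l2 l3 (C : point F),
    [/\ uniq [:: l1; l2; l3],
        [&& C \in pts l1, C \in pts l2 & C \in pts l3]
      & A = (pts l1 :|: pts l2 :|: pts l3) :\ C].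

End SemiArcs.

(* Main.v *)
(* Let C be the common point of l1 and l2 and put coordinates so that           *)

(* Counting tangents at the points of S on [l2] ([join_tangent]) makes every point of X impose an
   affine bijection from A onto B ([coord_maps_AB]). Counting tangents at a point R of X shows that
   exactly one of its t + 1 joins to the points of [l1] outside S is a secant ([X_secant]).

   When t is invertible in F, equality of sums identifies the foot of this secant on [l1] with the
   centroid of A, so X lies on one line through a removed point of [l1] ([X_centroid]). That line
   also passes through a removed point of [l2], and is the third side of the triangle in (b). Two
   points of X on it give two affine maps agreeing at a point of A; comparing products with exponent
   t - 1 makes this impossible under the hypotheses of (a), so X is empty ([X_eq0]).

   For (c), products with exponent t show that the line joining two points of X meets [l1] outside
   S. As only one such line through R is a secant, X is collinear ([X_coprime]); the foot is either
   a removed point, giving a triangle, or C, giving a pencil. *)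
(* l1 = <c, u>, l2 = <c, w>, C = <c>.  The points <w + b u + a c>, <u + x c>    *)
(* and <w + y c> are collinear iff y = a - b x.  Let A and B be the coordinates *)
(* of the t points missing from l1 and l2, and X the part of S off l1 and l2.   *)
(* The tangents at a point of S on l2 are the lines joining it to the missing   *)
(* points of l1, so each (a, b) in X induces a bijection x |-> a - b x from A   *)
(* onto B.  Comparing the sums over A and B, X is collinear when t != 0 in F;   *)
(* comparing the products over A and B centred at a point x0 common to two      *)
(* points (a, b) and (a', b') of X gives (b / b') ^ #|A \ {x0}| = 1, which      *)
(* forces b = b' when the exponent is coprime to #|F| - 1.                      *)
Require Import Defs.
From mathcomp Require Import all_boot all_order all_algebra all_field.
From mathcomp Require Import ring.
Set Implicit Arguments.
Unset Strict Implicit.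
Unset Printing Implicit Defensive.
Import GRing.Theory.

(** * Affine bijections between two finite subsets of a field *)

Section Affine.

Local Open Scope ring_scope.

Variables (F : finFieldType) (A B : {set F}).
Hypothesis cardAB : #|A| = #|B|.

Definition maps_AB (a b : F) := b != 0 /\ {in A, forall x, a - b * x \in B}.

Lemma affine_inj (a b : F) : b != 0 -> injective (fun x => a - b * x).
Proof. by move=> b0 x y /addrI/oppr_inj/(mulfI b0). Qed.

Lemma maps_AB_imset a b : maps_AB a b -> [set a - b * x | x in A] = B.
Proof.
case=> b0 AB; apply/eqP; rewrite eqEcard.
rewrite (card_imset _ (affine_inj (a := a) b0)) cardAB leqnn andbT.
by apply/subsetP => _ /imsetP[x Ax ->]; apply: AB.
Qed.

Lemma maps_AB_sum a b : maps_AB a b ->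
  \sum_(y in B) y = a *+ #|A| - b * \sum_(x in A) x.
Proof.
move=> ab; have [b0 _] := ab.
rewrite -(maps_AB_imset ab) big_imset /=; last by move=> x y _ _; apply: affine_inj.
by rewrite big_split /= sumr_const sumrN mulr_sumr.
Qed.

(** Each factor satisfies y - y0 = - b (x - x0). The centre [x0] may lie in A or not; the exponent
    is then t - 1 or t, which serve (a) and (c) respectively. *)
Lemma maps_AB_prod a b x0 : maps_AB a b ->
  \prod_(y in B :\ (a - b * x0)) (y - (a - b * x0)) =
  (- b) ^+ #|A :\ x0| * \prod_(x in A :\ x0) (x - x0).
Proof.
move=> ab; have [b0 _] := ab; have inj := affine_inj (a := a) b0.
have -> : B :\ (a - b * x0) = [set a - b * x | x in A :\ x0].
  apply/setP => y; rewrite -(maps_AB_imset ab) !inE.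
  apply/andP/imsetP => [[yx /imsetP[x Ax ey]]|[x]].
    by exists x => //; rewrite !inE Ax andbT; apply: contra_neq yx => <-.
  rewrite !inE => /andP[xx Ax] ->; split; last exact: imset_f.
  by apply: contra_neq xx => /inj.
rewrite big_imset /=; last by move=> x y _ _; apply: inj.
rewrite -prodr_const -big_split /=; apply: eq_bigr => x _; ring.
Qed.

Lemma expf_coprime_eq1 (k : F) n : k != 0 -> coprime #|F|.-1 n ->
  k ^+ n = 1 -> k = 1.
Proof.
move=> k0 /eqP cop kn.
have F1 : (0 < #|F|.-1)%N by rewrite -subn1 subn_gt0 finNzRing_gt1.
have kq : k ^+ #|F|.-1 = 1.
  by apply: (mulfI k0); rewrite -exprS prednK ?expf_card ?mulr1 //
     ltnW ?finNzRing_gt1.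
(* Bezout: a multiple of q - 1 exceeds a multiple of [n] by 1, and [k] is killed by both
   exponents. *)
have [c d e _] := egcdnP n F1; have : k ^+ (c * #|F|.-1) = k ^+ (d * n + 1).
  by rewrite e cop.
by rewrite exprD !(mulnC _ n) mulnC !exprM kq kn !expr1n mul1r expr1.
Qed.

Lemma maps_AB_coprime a a' b b' x0 :
    maps_AB a b -> maps_AB a' b' -> a - b * x0 = a' - b' * x0 ->
    coprime #|F|.-1 #|A :\ x0| -> b = b'.
Proof.
move=> ab ab' e cop; have [[b0 _] [b0' _]] := (ab, ab').
have := maps_AB_prod x0 ab; rewrite e (maps_AB_prod x0 ab').
have nz : \prod_(x in A :\ x0) (x - x0) != 0.
  by apply/prodf_neq0 => x; rewrite !inE subr_eq0 => /andP[].
move=> /(mulIf nz) eb; symmetry; apply: (mulIf (invr_neq0 b0)); rewrite divff //.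
apply: (expf_coprime_eq1 _ cop); first by rewrite mulf_neq0 ?invr_neq0.
rewrite -[b']opprK -[b in _ / b]opprK invrN mulrNN expr_div_n -eb divff //.
by rewrite expf_neq0 // oppr_eq0.
Qed.

End Affine.

(** * Incidence in the plane via ranks of row spaces *)

Section Incidence.

Local Open Scope ring_scope.
Variable F : finFieldType.
Implicit Types (l m : line F) (P Q R : point F) (v : 'rV[F]_3).

Lemma rank_subspace d (A : subspace F d) : \rank A = d.
Proof. by case: A => A /= /andP[_ /eqP]. Qed.

Lemma subspace_eq d (A B : subspace F d) : (A <= B)%MS -> A = B.
Proof.
move=> sAB; have [_ rAB] := mxrank_leqif_eq sAB.
move: rAB; rewrite !rank_subspace eqxx => /esym/genmxP.
case: A B {sAB} => A pA [B pB] /= eAB; apply: val_inj => /=.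
by case/andP: pA => /eqP <- _; case/andP: pB => /eqP <- _.
Qed.

(** [P0] is a default, returned only for the zero vector. *)
Definition pt (P0 : point F) v : point F := insubd P0 <<v>>%MS.

Lemma ptE P0 v : v != 0 -> (pt P0 v :=: v)%MS.
Proof.
move=> v0; rewrite /pt insubdK; first exact: genmxE.
by rewrite unfold_in /= genmx_id eqxx /= genmxE rank_rV v0.
Qed.

Lemma subspace_row P : exists v : 'rV[F]_3, (P :=: v)%MS.
Proof.
have P0 : (P : 'M[F]_3) != 0 by rewrite -mxrank_eq0 rank_subspace.
have /rowV0Pn[v vP v0] := P0; exists v.
have [_] := mxrank_leqif_eq vP.
by rewrite rank_rV v0 rank_subspace eqxx => /esym/eqmxP/eqmx_sym.
Qed.

Lemma rank_adds P Q : P != Q -> \rank (P + Q)%MS = 2.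
Proof.
move=> PQ; apply/eqP; rewrite eqn_leq; apply/andP; split.
  by rewrite (leq_trans (mxrank_adds_leqif _ _)) // !rank_subspace.
have := mxrank_leqif_eq (addsmxSl P Q); rewrite rank_subspace => -[].
rewrite leq_eqVlt => /orP[/eqP r1|//]; rewrite -r1 eqxx => /esym/eqmxP PQE.
case/negP: PQ; apply/eqP; symmetry; apply: subspace_eq.
by rewrite PQE addsmxSr.
Qed.

(** [l] is a default, returned only when the two points coincide. *)
Definition join l P Q : line F := insubd l <<(P + Q)%MS>>%MS.

Lemma joinE l P Q : P != Q -> (join l P Q :=: P + Q)%MS.
Proof.
move=> PQ; rewrite /join insubdK; first exact: genmxE.
by rewrite unfold_in /= genmx_id eqxx /= genmxE rank_adds.
Qed.

Lemma join_l l P Q : P != Q -> (P <= join l P Q)%MS.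
Proof. by move=> PQ; rewrite joinE // addsmxSl. Qed.

Lemma join_r l P Q : P != Q -> (Q <= join l P Q)%MS.
Proof. by move=> PQ; rewrite joinE // addsmxSr. Qed.

Lemma join_eq l m P Q : P != Q -> (P <= m)%MS -> (Q <= m)%MS -> join l P Q = m.
Proof.
by move=> PQ Pm Qm; apply: subspace_eq; rewrite joinE // addsmx_sub Pm.
Qed.

Lemma line_eq l m P Q :
    P != Q -> (P <= l)%MS -> (Q <= l)%MS -> (P <= m)%MS -> (Q <= m)%MS ->
  l = m.
Proof. by move=> PQ *; transitivity (join l P Q); [symmetry|]; apply: join_eq. Qed.

Lemma point_eq l m P Q :
    l != m -> (P <= l)%MS -> (Q <= l)%MS -> (P <= m)%MS -> (Q <= m)%MS ->
  P = Q.
Proof.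
move=> lm Pl Ql Pm Qm; have [//|PQ] := eqVneq P Q.
by case/eqP: lm; apply: line_eq PQ _ _ _ _.
Qed.

Lemma lines_span l m : l != m -> (1%:M <= l + m)%MS.
Proof.
move=> lm; rewrite sub1mx row_full_unit -row_free_unit -row_leq_rank.
have := mxrank_leqif_eq (addsmxSl l m); rewrite rank_subspace => -[].
rewrite leq_eqVlt => /orP[/eqP r1|//]; rewrite -r1 eqxx => /esym/eqmxP E.
case/negP: lm; apply/eqP; symmetry; apply: subspace_eq.
by rewrite E addsmxSr.
Qed.

Lemma lines_meet (P0 : point F) l m : exists P, (P <= l)%MS && (P <= m)%MS.
Proof.
have cap0 : (l :&: m)%MS != 0 :> 'M[F]_3.
  rewrite -mxrank_eq0 -lt0n; have := mxrank_sum_cap l m.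
  rewrite !rank_subspace; have := rank_leq_row (l + m)%MS.
  case: (\rank (l :&: m)%MS) => // r3 r4.
  by move: r3; rewrite -[X in (X <= _)%N]addn0 r4.
have /rowV0Pn[v vP v0] := cap0; exists (pt P0 v).
by rewrite !ptE // -sub_capmx.
Qed.

Lemma line_row l P : exists2 v : 'rV[F]_3, (v <= l)%MS & ~~ (v <= P)%MS.
Proof.
have /row_subPn[i] : ~~ (l <= P)%MS.
  by apply: contraTN (leqnn 2) => /mxrankS; rewrite !rank_subspace.
by exists (row i l) => //; apply: row_sub.
Qed.

End Incidence.

(** * Coordinates adapted to the two lines *)

Section Frame.

Local Open Scope ring_scope.

Variables (F : finFieldType) (l1 l2 : line F) (C : point F).
Variables (c u w : 'rV[F]_3).
Hypotheses (l12 : l1 != l2) (Cl1 : (C <= l1)%MS) (Cl2 : (C <= l2)%MS).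
Hypothesis (Cc : (C :=: c)%MS).
Hypotheses (ul1 : (u <= l1)%MS) (uC : ~~ (u <= C)%MS).
Hypotheses (wl2 : (w <= l2)%MS) (wC : ~~ (w <= C)%MS).
Implicit Types (l : line F) (P : point F) (a b x y : F).

Lemma sub_l1_l2 (v : 'rV[F]_3) : (v <= l1)%MS -> (v <= l2)%MS -> (v <= C)%MS.
Proof.
move=> v1 v2; have [->|v0] := eqVneq v 0; first exact: sub0mx.
by rewrite -(ptE C v0) (point_eq (P := pt C v) (Q := C) l12) ?ptE.
Qed.

Lemma cl1 : (c <= l1)%MS. Proof. by rewrite -Cc. Qed.
Lemma cl2 : (c <= l2)%MS. Proof. by rewrite -Cc. Qed.
Lemma ul2 : ~~ (u <= l2)%MS. Proof. by apply: contra uC; apply: sub_l1_l2. Qed.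
Lemma wl1 : ~~ (w <= l1)%MS.
Proof. by apply: contra wC => w1; apply: sub_l1_l2. Qed.

(** Affine charts in the basis [c], [u], [w]: [P1] and [P2] cover the two lines minus [C], and [P3]
    with [b] nonzero covers the points off both lines. Fixing [b] in [P3] fixes the line through
    [C]. *)
Definition P1 x := pt C (u + x *: c).
Definition P2 y := pt C (w + y *: c).
Definition P3 a b := pt C (w + b *: u + a *: c).

Lemma P1E x : (P1 x :=: (u + x *: c)%R)%MS.
Proof.
refine (ptE C _); apply: contraNneq uC => /eqP; rewrite addr_eq0 => /eqP ->.
by rewrite Cc eqmx_opp scalemx_sub.
Qed.

Lemma P2E y : (P2 y :=: (w + y *: c)%R)%MS.
Proof.
refine (ptE C _); apply: contraNneq wC => /eqP; rewrite addr_eq0 => /eqP ->.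
by rewrite Cc eqmx_opp scalemx_sub.
Qed.

Lemma sub_addl (v v' : 'rV[F]_3) a (A : 'M[F]_3) :
  (v' <= A)%MS -> ((v + a *: v')%R <= A)%MS = (v <= A)%MS.
Proof.
move=> vA; apply/idP/idP => h; last by rewrite addmx_sub ?scalemx_sub.
by rewrite -[v](addrK (a *: v')) addmx_sub // eqmx_opp scalemx_sub.
Qed.

Lemma P3E a b : (P3 a b :=: (w + b *: u + a *: c)%R)%MS.
Proof.
refine (ptE C _); apply: contraNneq wl1 => e.
by rewrite -(sub_addl w b ul1) -(sub_addl _ a cl1) e sub0mx.
Qed.

Lemma P1_l1 x : (P1 x <= l1)%MS. Proof. by rewrite P1E sub_addl // cl1. Qed.
Lemma P2_l2 y : (P2 y <= l2)%MS. Proof. by rewrite P2E sub_addl // cl2. Qed.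
Lemma P1_l2 x : ~~ (P1 x <= l2)%MS.
Proof. by rewrite P1E sub_addl ?ul2 ?cl2. Qed.
Lemma P2_l1 y : ~~ (P2 y <= l1)%MS.
Proof. by rewrite P2E sub_addl ?wl1 ?cl1. Qed.
Lemma P3_l1 a b : ~~ (P3 a b <= l1)%MS.
Proof. by rewrite P3E !sub_addl ?wl1 ?cl1. Qed.

Lemma P3_l2 a b : b != 0 -> ~~ (P3 a b <= l2)%MS.
Proof.
move=> b0; rewrite P3E sub_addl ?cl2 // -[w]scale1r addrC sub_addl //.
by apply: contra ul2 => h; rewrite -[u](scalerK b0) scalemx_sub.
Qed.

Lemma shift_inj (v : 'rV[F]_3) x y P :
  ~~ (v <= C)%MS -> ((v + x *: c)%R <= P)%MS -> ((v + y *: c)%R <= P)%MS -> x = y.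
Proof.
move=> vC vx vy; apply: contraNeq vC; rewrite -subr_eq0 => xy.
have cP : (c <= P)%MS.
  rewrite -[c]scale1r -(mulVf xy) -scalerA scalemx_sub // scalerBl.
  have -> : x *: c - y *: c = (v + x *: c) - (v + y *: c).
    by rewrite opprD addrACA subrr add0r.
  by rewrite addmx_sub // eqmx_opp.
have -> : C = P by apply: subspace_eq; rewrite Cc.
by rewrite -(sub_addl v x cP).
Qed.

Lemma P1_inj : injective P1.
Proof.
move=> x y e; apply: (shift_inj (P := P1 x) uC); first by rewrite P1E.
by rewrite e P1E.
Qed.

Lemma P2_inj : injective P2.
Proof.
move=> x y e; apply: (shift_inj (P := P2 x) wC); first by rewrite P2E.
by rewrite e P2E.
Qed.

Lemma line_decomp l (v z : 'rV[F]_3) :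
    (C <= l)%MS -> (v <= l)%MS -> ~~ (v <= C)%MS -> (z <= l)%MS ->
  exists b a, z = b *: v + a *: c.
Proof.
move=> Cl vl vC zl; have v0 : v != 0 by apply: contraNneq vC => ->; apply: sub0mx.
have CP : C != pt C v by apply: contraNneq vC => ->; rewrite ptE.
have : (z <= v + c)%MS.
  rewrite -(adds_eqmx (ptE C v0) Cc) addsmxC.
  by rewrite -(joinE l CP) (join_eq l (m:=l)) ?ptE.
case/sub_addsmxP => -[d e] /= ->; exists (d 0 0), (e 0 0).
by rewrite -!mul_scalar_mx -!mx11_scalar.
Qed.

Lemma line_param l (v : 'rV[F]_3) P :
    (C <= l)%MS -> (v <= l)%MS -> ~~ (v <= C)%MS -> (P <= l)%MS -> P != C ->
  exists x, ((v + x *: c)%R <= P)%MS.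
Proof.
move=> Cl vl vC Pl PC; have [z Pz] := subspace_row P.
have [|b [a ez]] := line_decomp Cl vl vC (z := z); first by rewrite -Pz.
have b0 : b != 0.
  apply: contraNneq PC => b0; apply/eqP/subspace_eq.
  by rewrite Pz ez b0 scale0r add0r scalemx_sub ?Cc.
exists (b^-1 * a); rewrite Pz.
have -> : v + (b^-1 * a) *: c = b^-1 *: z; last exact: scalemx_sub.
by rewrite ez scalerDr !scalerA mulVf // scale1r.
Qed.

Lemma on_l1 P : (P <= l1)%MS -> P != C -> exists x, P = P1 x.
Proof.
move=> Pl PC; have [x xP] := line_param Cl1 ul1 uC Pl PC.
by exists x; symmetry; apply: subspace_eq; rewrite P1E.
Qed.

Lemma on_l2 P : (P <= l2)%MS -> P != C -> exists y, P = P2 y.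
Proof.
move=> Pl PC; have [x xP] := line_param Cl2 wl2 wC Pl PC.
by exists x; symmetry; apply: subspace_eq; rewrite P2E.
Qed.

Lemma off_l12 P :
  ~~ (P <= l1)%MS -> ~~ (P <= l2)%MS -> exists a b, b != 0 /\ P = P3 a b.
Proof.
move=> P1' P2'; have [z Pz] := subspace_row P.
have /sub_addsmxP[[d e] /= ez] : (z <= l1 + l2)%MS.
  exact: submx_trans (submx1 _) (lines_span l12).
have [b1 [a1 e1]] := line_decomp Cl1 ul1 uC (submxMl d l1).
have [b2 [a2 e2]] := line_decomp Cl2 wl2 wC (submxMl e l2).
move: ez; rewrite e1 e2 => ez {d e e1 e2}.
have b20 : b2 != 0.
  apply: contraNneq P1' => b0; rewrite Pz ez b0 scale0r add0r.
  by rewrite !sub_addl ?cl1 ?scalemx_sub.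
have b10 : b1 != 0.
  apply: contraNneq P2' => b0; rewrite Pz ez b0 scale0r add0r addrC.
  by rewrite !sub_addl ?cl2 ?scalemx_sub.
(* Dividing by [b2] normalises the coefficient of [w] to 1. *)
exists (b2^-1 * (a1 + a2)), (b2^-1 * b1); split.
  by rewrite mulf_neq0 ?invr_neq0.
symmetry; apply: subspace_eq; rewrite P3E Pz.
suff -> : w + (b2^-1 * b1) *: u + (b2^-1 * (a1 + a2)) *: c = b2^-1 *: z.
  exact: scalemx_sub.
rewrite ez -!scalerA -[in LHS](scalerK b20 w) -!scalerDr; congr (_ *: _).
by rewrite scalerDl; apply/matrixP => i j; rewrite !mxE; ring.
Qed.

Lemma P2_on_join l a b x :
  (P3 a b <= l)%MS -> (P1 x <= l)%MS -> (P2 (a - b * x) <= l)%MS.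
Proof.
rewrite P3E P1E P2E => l3 l1'.
have -> : w + (a - b * x) *: c =
    (w + b *: u + a *: c) + (- b) *: (u + x *: c).
  by apply/matrixP => i j; rewrite !mxE; ring.
by rewrite sub_addl.
Qed.

Lemma P3_on_join l a b x :
  (P1 x <= l)%MS -> (P2 (a - b * x) <= l)%MS -> (P3 a b <= l)%MS.
Proof.
rewrite P3E P1E P2E => l1' l2'.
have -> : w + b *: u + a *: c = (w + (a - b * x) *: c) + b *: (u + x *: c).
  by apply/matrixP => i j; rewrite !mxE; ring.
by rewrite sub_addl.
Qed.

Lemma P3_on_pencil l a a' b :
  (C <= l)%MS -> (P3 a b <= l)%MS -> (P3 a' b <= l)%MS.
Proof.
rewrite !P3E => Cl; have cl : (c <= l)%MS by rewrite -Cc.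
by rewrite !(sub_addl _ _ cl).
Qed.

Lemma P3_pencil_eq l a a' b b' :
  (C <= l)%MS -> (P3 a b <= l)%MS -> (P3 a' b' <= l)%MS -> b = b'.
Proof.
rewrite !P3E => Cl; have cl : (c <= l)%MS by rewrite -Cc.
rewrite !(sub_addl _ _ cl) => h h'; apply: contraNeq (P3_l1 0 b) => bb.
have bb0 : b - b' != 0 by rewrite subr_eq0.
have ul : (u <= l)%MS.
  rewrite -[u]scale1r -(mulVf bb0) -scalerA scalemx_sub // scalerBl.
  have -> : b *: u - b' *: u = (w + b *: u) - (w + b' *: u).
    by apply/matrixP => i j; rewrite !mxE; ring.
  by rewrite addmx_sub // eqmx_opp.
have lE : l = l1.
  have CP : C != P1 0 by apply: contraNneq uC => ->; rewrite P1E scale0r addr0.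
  by apply: (line_eq CP) => //; rewrite ?P1_l1 // P1E scale0r addr0.
by rewrite P3E scale0r addr0 -lE.
Qed.

(** * The semiarc on the two lines and its tangents there *)

Variables (S N1 N2 : {set point F}) (t : nat).
Hypotheses (tangentS : forall P, P \in S -> #|tangents S P| = t).
Hypotheses (CS : C \notin S) (t_lt : (t < #|F| - 1)%N).
Hypotheses (N1sub : N1 \subset pts l1 :\: pts l2).
Hypotheses (N2sub : N2 \subset pts l2 :\: pts l1).
Hypotheses (N1card : #|N1| = t) (N2card : #|N2| = t).
Hypotheses (l1S : {in pts l1 :\: pts l2, forall P, (P \in S) = (P \notin N1)}).
Hypotheses (l2S : {in pts l2 :\: pts l1, forall P, (P \in S) = (P \notin N2)}).

Let A := [set x | P1 x \in N1].
Let B := [set y | P2 y \in N2].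

Lemma N1_l1 P : P \in N1 -> (P <= l1)%MS /\ ~~ (P <= l2)%MS.
Proof. by move=> /(subsetP N1sub); rewrite !inE => /andP[]. Qed.

Lemma N2_l2 P : P \in N2 -> (P <= l2)%MS /\ ~~ (P <= l1)%MS.
Proof. by move=> /(subsetP N2sub); rewrite !inE => /andP[]. Qed.

Lemma N1_P1 P : P \in N1 -> exists2 x, x \in A & P = P1 x.
Proof.
move=> PN; have [Pl1 Pl2] := N1_l1 PN.
have [|x e] := on_l1 Pl1; first by apply: contraNneq Pl2 => ->.
by exists x; rewrite // inE -e.
Qed.

Lemma N2_P2 P : P \in N2 -> exists2 y, y \in B & P = P2 y.
Proof.
move=> PN; have [Pl2 Pl1] := N2_l2 PN.
have [|y e] := on_l2 Pl2; first by apply: contraNneq Pl1 => ->.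
by exists y; rewrite // inE -e.
Qed.

Lemma card_A : #|A| = t.
Proof.
rewrite -N1card -(card_imset _ P1_inj); apply: eq_card => P.
apply/imsetP/idP => [[x xA ->]|/N1_P1[x xA ->]]; last by exists x.
by rewrite inE in xA.
Qed.

Lemma card_B : #|B| = t.
Proof.
rewrite -N2card -(card_imset _ P2_inj); apply: eq_card => P.
apply/imsetP/idP => [[x xA ->]|/N2_P2[x xA ->]]; last by exists x.
by rewrite inE in xA.
Qed.

Lemma P1_S x : (P1 x \in S) = (x \notin A).
Proof. by rewrite l1S !inE ?P1_l1 ?(negPf (P1_l2 x)). Qed.

Lemma P2_S y : (P2 y \in S) = (y \notin B).
Proof. by rewrite l2S !inE ?P2_l2 ?(negPf (P2_l1 y)). Qed.

Lemma N1_S P : P \in N1 -> P \notin S.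
Proof. by case/N1_P1 => x xA ->; rewrite P1_S xA. Qed.

Lemma N2_S P : P \in N2 -> P \notin S.
Proof. by case/N2_P2 => x xA ->; rewrite P2_S xA. Qed.

Lemma l1_notS P : (P <= l1)%MS -> P \notin S -> P \in C |: N1.
Proof.
move=> Pl1 PS; rewrite !inE; have [//|/= PC] := eqVneq P C.
by have [x e] := on_l1 Pl1 PC; move: PS; rewrite e P1_S negbK inE.
Qed.

Lemma C1N1_notS P : P \in C |: N1 -> P \notin S.
Proof. by rewrite !inE => /orP[/eqP -> //|/N1_S]. Qed.

Lemma C1N1_l1 P : P \in C |: N1 -> (P <= l1)%MS.
Proof. by rewrite !inE => /orP[/eqP -> //|/N1_l1[]]. Qed.

Lemma tangentP l P R : l \in tangents S P -> R \in S -> (R <= l)%MS -> R = P.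
Proof.
rewrite inE => /eqP e RS Rl; apply/set1P; rewrite -e !inE RS Rl //.
Qed.

Lemma tangent_sub l P : l \in tangents S P -> (P <= l)%MS.
Proof. by rewrite inE => /eqP/setP/(_ P); rewrite !inE eqxx => /andP[]. Qed.

Lemma l2_not_tangent P : P \in S -> l2 \notin tangents S P.
Proof.
move=> PS; apply/negP => tl; have Pl := tangent_sub tl.
have [|y Py] := on_l2 Pl; first by apply: contraNneq CS => <-.
(* Exactly q - t affine points of [l2] lie in S, and q - t is at least 2, so [l2] carries another
   point of S. *)
have : (0 < #|~: B :\ y|)%N.
  have := cardsC B; have := cardsD1 y (~: B).
  rewrite inE -P2_S -Py PS card_B => -> e.
  by rewrite lt0n; apply: contraTneq t_lt => z; rewrite -e z addn0 addn1 subn1 ltnn.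
case/card_gt0P => z; rewrite !inE => /andP[zy zB].
case/eqP: zy; apply: P2_inj; rewrite -Py; apply: (tangentP tl); last exact: P2_l2.
by rewrite P2_S inE.
Qed.

(** A tangent at [P] meets [l1] outside S, and not at [C] because [l2] is not a tangent. So the t
    tangents are among the joins of [P] to the t points of [N1], and must exhaust them. *)
Lemma join_tangent P Q l :
    P \in S -> (P <= l2)%MS -> Q \in N1 -> (P <= l)%MS -> (Q <= l)%MS ->
  l \in tangents S P.
Proof.
move=> PS Pl2 QN Pl Ql.
have PN Q' : Q' \in N1 -> P != Q'.
  by move=> QN'; apply: contraTneq PS => ->; apply: N1_S.
have /eqP e : tangents S P == [set join l2 P Q | Q in N1]; last first.
  rewrite e; apply/imsetP; exists Q => //.
  by symmetry; apply: join_eq => //; apply: PN.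
rewrite eqEcard tangentS // -N1card leq_imset_card andbT.
apply/subsetP => m tm; have Pm := tangent_sub tm.
have [Q' /andP[Q'm Q'l1]] := lines_meet C m l1.
have Pl1 : ~~ (P <= l1)%MS.
  by apply: contraNN CS => Pl1; rewrite -(point_eq l12 Pl1 Cl1 Pl2 Cl2).
have PQ : P != Q' by apply: contraNneq Pl1 => ->.
have Q'S : Q' \notin S.
  by apply: contra PQ => Q'S; rewrite (tangentP tm Q'S Q'm).
have := l1_notS Q'l1 Q'S; rewrite !inE => /orP[/eqP e|Q'N].
  case/negP: (l2_not_tangent PS).
  by rewrite (line_eq PQ Pl2 _ Pm Q'm) // e.
by apply/imsetP; exists Q' => //; symmetry; apply: join_eq.
Qed.

(** If the join of [P3 a b] and a removed point of [l1] met [l2] in a point of S, it would be a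
    tangent there and could not contain [P3 a b]. *)
Lemma coord_maps_AB a b :
  P3 a b \in S -> ~~ (P3 a b <= l2)%MS -> b != 0 -> maps_AB A B a b.
Proof.
move=> RS Rl2 b0; split=> // x xA; apply/negPn; rewrite -P2_S; apply/negP => yS.
set P := P2 _ in yS.
have PQ : P != P1 x.
  by apply: contraNneq (P2_l1 (a - b * x)) => e; rewrite -/P e P1_l1.
have tl : join l2 P (P1 x) \in tangents S P.
  apply: (join_tangent (Q := P1 x)) => //; rewrite ?P2_l2 ?join_l ?join_r //.
  by rewrite inE in xA.
case/negP: Rl2; rewrite (tangentP tl RS) ?P2_l2 //.
exact: P3_on_join (join_r _ PQ) (join_l _ PQ).
Qed.

(** * Secants through the points of the semiarc off the two lines *)

Let X := S :\: (pts l1 :|: pts l2).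

Lemma X_coord (R : point F) : R \in X ->
  exists a b, [/\ R = P3 a b, P3 a b \in S & maps_AB A B a b].
Proof.
rewrite !inE negb_or -andbA => /and3P[Rl1 Rl2 RS].
have [a [b [b0 Re]]] := off_l12 Rl1 Rl2.
by exists a, b; rewrite -Re; split=> //; apply: coord_maps_AB => //; rewrite -Re.
Qed.

Lemma join_l1_inj (R : point F) : ~~ (R <= l1)%MS ->
  {in C |: N1 &, injective (join l1 R)}.
Proof.
move=> Rl1 Q Q' QN Q'N e.
have RQ P : P \in C |: N1 -> R != P.
  by move/C1N1_l1 => Pl1; apply: contraNneq Rl1 => ->.
have jl : join l1 R Q != l1 by apply: contraNneq Rl1 => <-; apply/join_l/RQ.
apply: (point_eq jl); rewrite ?C1N1_l1 //; first exact/join_r/RQ.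
by rewrite e; apply/join_r/RQ.
Qed.

(* The t tangents at R are among the t + 1 lines joining R to the points of    *)
(* l1 outside S, so exactly one of these lines meets X again.                  *)
Lemma X_secant (R : point F) : R \in X -> exists Q,
  [/\ Q \in C |: N1,
      exists2 R', R' \in X :\ R & (R' <= join l1 R Q)%MS
    & forall Q' R', Q' \in C |: N1 -> R' \in S :\ R ->
        (R' <= join l1 R Q')%MS -> Q' = Q].
Proof.
rewrite !inE negb_or -andbA => /and3P[Rl1 Rl2 RS].
have RQ P : P \in C |: N1 -> R != P.
  by move/C1N1_l1 => Pl1; apply: contraNneq Rl1 => ->.
pose L := [set join l1 R Q | Q in C |: N1].
have tL : tangents S R \subset L.
  apply/subsetP => l tl; have [Q /andP[Ql Ql1]] := lines_meet C l l1.
  have RQ' : R != Q by apply: contraNneq Rl1 => ->.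
  have QN : Q \in C |: N1.
    apply: l1_notS => //; apply: contra RQ' => QS.
    by rewrite (tangentP tl QS Ql).
  apply/imsetP; exists Q => //; symmetry.
  by apply: join_eq => //; apply: tangent_sub.
have CN1 : C \notin N1 by apply/negP => /N1_l1[_]; rewrite Cl2.
have : #|L :\: tangents S R| == 1.
  rewrite cardsD (setIidPr tL) tangentS // (card_in_imset (join_l1_inj Rl1)).
  by rewrite cardsU1 CN1 N1card add1n subSnn.
case/cards1P => m Lm; have : m \in L :\: tangents S R by rewrite Lm inE.
rewrite inE => /andP[mt /imsetP[Q QN em]]; exists Q; split=> //; last first.
  (* Every join other than [m] is a tangent at [R], hence has no second point of S. *)
  move=> Q' R' Q'N; rewrite !inE => /andP[R'R R'S] R'l.
  apply: (join_l1_inj Rl1) => //; rewrite -em; apply/set1P.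
  rewrite -Lm inE imset_f // andbT; apply: contra R'R => tl.
  by rewrite (tangentP tl R'S R'l).
have Rm : (R <= m)%MS by rewrite em join_l // RQ.
have Qm : (Q <= m)%MS by rewrite em join_r // RQ.
have /subsetPn[R'] : ~~ (pts m :&: S \subset [set R]).
  apply: contra mt => sub; rewrite inE eqEsubset sub.
  by apply/subsetP => P /set1P ->; rewrite !inE Rm RS.
rewrite !inE => /andP[R'm R'S] R'R.
have R'l1 : ~~ (R' <= l1)%MS.
  apply: contraTN R'S => R'l1; have ml : m != l1 by apply: contraNneq Rl1 => <-.
  by rewrite (point_eq ml R'm Qm R'l1) ?C1N1_notS ?C1N1_l1.
exists R'; last by rewrite -em.
rewrite !inE R'R R'S (negPf R'l1) /= andbT.
(* The second point cannot lie on [l2]: with foot [C] the secant would be [l2] itself, and with foot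
   in [N1] it would be a tangent at [R'] although it contains [R]. *)
move: QN; rewrite !inE => /orP[/eqP QC|QN].
  apply: contra Rl2 => R'l2.
  have R'C : R' != C by apply: contraNneq R'l1 => ->.
  by rewrite (line_eq R'C R'l2 Cl2 R'm) // -QC.
apply: contra R'R => R'l2; have tl := join_tangent R'S R'l2 QN R'm Qm.
by rewrite eq_sym (tangentP tl RS Rm).
Qed.

(** * Covering the semiarc by three lines *)

(** The vertices of the triangle are [C], [Q1] and [Q2], all outside S. *)
Lemma triangle_cover (m : line F) Q1 Q2 :
    Q1 \in N1 -> Q2 \in N2 -> (Q1 <= m)%MS -> (Q2 <= m)%MS -> X \subset pts m ->
  exists T : {set point F}, vertexless_triangle T /\ S \subset T.
Proof.
move=> Q1N Q2N Q1m Q2m Xm.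
have [Q1l1 Q1l2] := N1_l1 Q1N; have [Q2l2 Q2l1] := N2_l2 Q2N.
have ml1 : m != l1 by apply: contraNneq Q2l1 => <-.
have ml2 : m != l2 by apply: contraNneq Q1l2 => <-.
eexists; split.
  exists l1, l2, m; split; last by reflexivity.
  apply/eqP/set0Pn => -[P]; rewrite !inE -andbA => /and3P[Pl1 Pl2 Pm].
  by case/negP: Q1l2; rewrite -(point_eq ml1 Pm Q1m Pl1 Q1l1).
apply/subsetP => P PS; rewrite !inE; apply/andP; split.
  apply/negP => /orP[/orP[]|] /andP[].
  - by move=> Pl1 Pl2; case/negP: CS; rewrite -(point_eq l12 Pl1 Cl1 Pl2 Cl2).
  - by move=> Pl2 Pm; case/negP: (N2_S Q2N); rewrite -(point_eq ml2 Pm Q2m Pl2 Q2l2).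
  - by move=> Pl1 Pm; case/negP: (N1_S Q1N); rewrite -(point_eq ml1 Pm Q1m Pl1 Q1l1).
have [//|Pl1] := boolP (P <= l1)%MS; have [//|Pl2] := boolP (P <= l2)%MS.
by have /(subsetP Xm) : P \in X; rewrite !inE ?PS ?andbT ?negb_or ?Pl1.
Qed.

Lemma pencil_cover (m : line F) :
    (C <= m)%MS -> m != l1 -> m != l2 -> X \subset pts m ->
  exists T : {set point F}, punctured_pencil3 T /\ S \subset T.
Proof.
move=> Cm ml1 ml2 Xm; eexists; split.
  exists l1, l2, m, C; split; last by reflexivity.
    by rewrite /= !inE negb_or l12 eq_sym ml1 eq_sym ml2.
  by rewrite !inE Cl1 Cl2.
apply/subsetP => P PS; rewrite !inE; apply/andP; split.
  by apply: contraNneq CS => <-.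
have [//|Pl1] := boolP (P <= l1)%MS; have [//|Pl2] := boolP (P <= l2)%MS.
by have /(subsetP Xm) : P \in X; rewrite !inE ?PS ?andbT ?negb_or ?Pl1.
Qed.

Lemma X_notl1 (R : point F) : R \in X -> ~~ (R <= l1)%MS.
Proof. by rewrite !inE negb_or -andbA => /and3P[]. Qed.

Lemma X_notl2 (R : point F) : R \in X -> ~~ (R <= l2)%MS.
Proof. by rewrite !inE negb_or -andbA => /and3P[]. Qed.

Lemma X_neq (R Q : point F) : R \in X -> (Q <= l1)%MS -> R != Q.
Proof. by move=> /X_notl1 Rl1 Ql1; apply: contraNneq Rl1 => ->. Qed.

(** The affine map of [R] sends the coordinate of [Q] into B, so the line also meets [l2] in a
    removed point. *)
Lemma X_triangle (R Q : point F) :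
    R \in X -> Q \in N1 -> X \subset pts (join l1 R Q) ->
  exists T : {set point F}, vertexless_triangle T /\ S \subset T.
Proof.
move=> RX QN; have [Ql1 _] := N1_l1 QN; have RQ := X_neq RX Ql1.
have [x xA eQ] := N1_P1 QN; have [a [b [eR _ [_ AB]]]] := X_coord RX.
apply: (triangle_cover (m := join l1 R Q) (Q2 := P2 (a - b * x)) QN) => //.
- by have := AB _ xA; rewrite inE.
- exact: join_r.
- by apply: P2_on_join; rewrite -?eR -?eQ ?join_l ?join_r.
Qed.

(** * Collinearity of X and the three conclusions *)

Let cardAB : #|A| = #|B|. Proof. by rewrite card_A card_B. Qed.

(* Summing over A shows that t a - b (sum of A) is the same for all points     *)
(* (a, b) of X, so X lies on a line through the centroid of A.                 *)
Lemma X_centroid (R : point F) : t%:R != 0 :> F -> R \in X ->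
  exists a b a' b' x0,
    [/\ [/\ x0 \in A, maps_AB A B a b & maps_AB A B a' b'], b != b',
        a - b * x0 = a' - b' * x0 & X \subset pts (join l1 R (P1 x0))].
Proof.
move=> t0 RX; have [Q [QN [R']]] := X_secant RX.
rewrite in_setD1 => /andP[R'R R'X] R'm _.
have [a [b [eR RS ab]]] := X_coord RX; have [a' [b' [eR' _ ab']]] := X_coord R'X.
set s := \sum_(x in A) x.
have sumE a1 b1 : maps_AB A B a1 b1 -> a1 * t%:R - b1 * s = \sum_(y in B) y.
  by move=> ab1; rewrite (maps_AB_sum cardAB ab1) card_A mulr_natr.
have bb : b != b'.
  apply: contraNneq R'R => eb; rewrite eR eR' -eb; suff -> : a' = a by [].
  apply: (mulIf t0); apply: (addIr (- (b * s))).
  by rewrite (sumE _ _ ab) eb (sumE _ _ ab').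
have RQ := X_neq RX (C1N1_l1 QN).
set m := join l1 R Q in R'm.
have Rm : (R <= m)%MS by apply: join_l.
have Qm : (Q <= m)%MS by apply: join_r.
(* A secant through [C] would give both points the same [b], which [bb] excludes. *)
move: QN; rewrite !inE => /orP[/eqP QC|/N1_P1[x0 x0A eQ]].
  by case/eqP: bb; apply: (@P3_pencil_eq m a a' b b'); rewrite -?eR -?eR' -?QC.
have e : a - b * x0 = a' - b' * x0.
  have ml2 : m != l2 by apply: contraNneq (X_notl2 RX) => <-.
  apply: P2_inj; apply: (point_eq ml2); rewrite ?P2_l2 //; apply: P2_on_join.
  - by rewrite -eR.
  - by rewrite -eQ.
  - by rewrite -eR'.
  - by rewrite -eQ.
(* Subtracting the two sum identities and cancelling b - b' shows that the foot [x0] is the centroid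
   of A. *)
have sE : s = t%:R * x0.
  have bb0 : b - b' != 0 by rewrite subr_eq0.
  apply: (mulfI bb0); apply/eqP; rewrite -subr_eq0.
  have -> : (b - b') * s - (b - b') * (t%:R * x0) =
      t%:R * ((a - b * x0) - (a' - b' * x0)) -
      ((a * t%:R - b * s) - (a' * t%:R - b' * s)) by ring.
  by rewrite e (sumE _ _ ab) (sumE _ _ ab') !subrr mulr0 subrr.
exists a, b, a', b', x0; split=> //.
apply/subsetP => R2 /X_coord[a2 [b2 [-> _ ab2]]].
rewrite inE -eQ -/m; apply: (P3_on_join (x := x0)); first by rewrite -eQ.
have -> : a2 - b2 * x0 = a - b * x0.
  apply: (mulfI t0).
  have E a1 b1 : t%:R * (a1 - b1 * x0) = a1 * t%:R - b1 * s by rewrite sE; ring.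
  by rewrite !E (sumE _ _ ab) (sumE _ _ ab2).
by apply: P2_on_join; rewrite -?eR -?eQ.
Qed.

(** Every other point of X is joined to [R] by a line whose foot on [l1] is outside S; uniqueness in
    [X_secant] makes all these lines equal. *)
Lemma X_coprime (R : point F) : coprime #|F|.-1 t -> R \in X ->
  exists2 Q, Q \in C |: N1 & X \subset pts (join l1 R Q).
Proof.
move=> cop RX; have [Q [QN _ Quniq]] := X_secant RX; exists Q => //.
have [a [b [eR RS ab]]] := X_coord RX.
apply/subsetP => R2 R2X; rewrite inE.
have [->|R2R] := eqVneq R2 R; first exact/join_l/X_neq/C1N1_l1.
have [a2 [b2 [eR2 R2S ab2]]] := X_coord R2X.
have R2SR : R2 \in S :\ R by rewrite in_setD1 R2R eR2.
have [eb|bb] := eqVneq b b2.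
  have R2C : (R2 <= join l1 R C)%MS.
    have RC := X_neq RX Cl1.
    by rewrite eR2 -eb; apply: (P3_on_pencil (a := a)); rewrite -?eR ?join_l ?join_r.
  by rewrite -(Quniq C R2) // setU11.
pose x := (a - a2) / (b - b2).
have e : a - b * x = a2 - b2 * x.
  have bb0 : b - b2 != 0 by rewrite subr_eq0.
  by rewrite /x; field.
(* For [x] outside A, removing [x] leaves all t elements, so the product comparison would force b =
   b2. *)
have xA : x \in A.
  apply: contraNT bb => xA; apply/eqP; apply: (maps_AB_coprime cardAB ab ab2 e).
  by have := cardsD1 x A; rewrite (negPf xA) card_A add0n => <-.
have Rx := X_neq RX (P1_l1 x).
have R2x : (R2 <= join l1 R (P1 x))%MS.
  rewrite eR2; apply: (P3_on_join (x := x)); first exact: join_r.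
  by rewrite -e; apply: P2_on_join; rewrite -?eR ?join_l ?join_r.
by rewrite -(Quniq (P1 x) R2) // !inE; move: xA; rewrite inE => ->; rewrite orbT.
Qed.

Lemma S_sub_symdiff : X = set0 -> S \subset symdiff (pts l1) (pts l2).
Proof.
move=> X0; apply/subsetP => P PS; rewrite !inE; move/setP/(_ P): X0.
rewrite !inE PS andbT => /negbFE; case Pl1: (P <= l1)%MS => /= Pl2; rewrite ?Pl2 //.
rewrite andbT orbF; apply: contra CS => Pl2'.
by rewrite -(point_eq l12 Pl1 Cl1 Pl2' Cl2).
Qed.

(** Two points of X share the centroid [x0], which lies in A, so the exponent is t - 1. *)
Lemma X_eq0 : t%:R != 0 :> F -> coprime #|F|.-1 t.-1 -> X = set0.
Proof.
move=> t0 cop; apply/eqP; apply: contraT => /set0Pn[R RX].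
have [a [b [a' [b' [x0 [[x0A ab ab'] bb e _]]]]]] := X_centroid t0 RX.
case/eqP: bb; apply: (maps_AB_coprime cardAB ab ab' e).
by have := cardsD1 x0 A; rewrite x0A card_A add1n => et; move: cop; rewrite {1}et.
Qed.

Lemma triangle_of_centroid : t%:R != 0 :> F ->
  exists T : {set point F}, vertexless_triangle T /\ S \subset T.
Proof.
move=> t0; have [X0|/set0Pn[R RX]] := eqVneq X set0.
  (* With X empty, any line through a removed point of each line serves; such points exist as t is
     positive. *)
  have t1 : (0 < t)%N by rewrite lt0n; apply: contraNneq t0 => ->.
  have /card_gt0P[Q1 Q1N] : (0 < #|N1|)%N by rewrite N1card.
  have /card_gt0P[Q2 Q2N] : (0 < #|N2|)%N by rewrite N2card.
  have QQ : Q1 != Q2.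
    by have [_ h] := N1_l1 Q1N; have [h' _] := N2_l2 Q2N; apply: contraNneq h => ->.
  apply: (triangle_cover (m := join l1 Q1 Q2) Q1N Q2N); rewrite ?join_l ?join_r //.
  by rewrite X0 sub0set.
have [a [b [a' [b' [x0 [[x0A _ _] _ _ Xm]]]]]] := X_centroid t0 RX.
by apply: X_triangle RX _ Xm; rewrite inE in x0A.
Qed.

Lemma cover_of_coprime : coprime #|F|.-1 t ->
  (exists T : {set point F}, vertexless_triangle T /\ S \subset T) \/
  (exists T : {set point F}, punctured_pencil3 T /\ S \subset T).
Proof.
move=> cop.
have pen (R : point F) :
    ~~ (R <= l1)%MS -> ~~ (R <= l2)%MS -> X \subset pts (join l1 R C) ->
    exists T : {set point F}, punctured_pencil3 T /\ S \subset T.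
  move=> Rl1 Rl2; have RC : R != C by apply: contraNneq Rl1 => ->.
  by apply: pencil_cover; first exact: join_r;
    [apply: contraNneq Rl1 | apply: contraNneq Rl2] => <-; apply: join_l.
have [X0|/set0Pn[R RX]] := eqVneq X set0.
  (* With X empty, any third line through [C] serves. *)
  right; apply: (pen (P3 0 1)); rewrite ?P3_l1 ?P3_l2 ?oner_eq0 //.
  by rewrite X0 sub0set.
have [Q QN Xm] := X_coprime cop RX.
move: QN; rewrite in_setU1 => /orP[/eqP eQ|QN]; last first.
  by left; apply: X_triangle RX QN Xm.
by right; apply: (pen R); rewrite ?X_notl1 ?X_notl2 // -eQ.
Qed.

End Frame.

(** * Choice of the frame and translation of the gcd conditions *)

Theorem theorem4p6 (p r q t : nat) (F : finFieldType) (S : {set point F})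
    (p_prime : prime p) (r_gt0 : 0 < r) (q_def : q = p ^ r) (cardF : #|F| = q)
    (t_lt : t < q - 1) (S_semiarc : semiarc t S) (S_V : V_circ_type t S) :
  [/\ gcdn q t = 1 -> gcdn (q - 1) (t - 1) = 1 -> V_config t S,
      gcdn q t = 1 ->
        exists A : {set point F}, vertexless_triangle A /\ S \subset A
    & gcdn (q - 1) t = 1 ->
        (exists A : {set point F}, vertexless_triangle A /\ S \subset A) \/
        (exists A : {set point F}, punctured_pencil3 A /\ S \subset A)].
Proof.
have [[SN0 tangentS] [l1 [l2 [l12 dis cfg]]]] := (S_semiarc, S_V).
have [N1 [N2 [N1sub N1card N2sub N2card E]]] := cfg.
have [P0 _] : exists P, P \in S by apply/set0Pn.
have [C /andP[Cl1 Cl2]] := lines_meet P0 l1 l2.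
have [c Cc] := subspace_row C.
have [u ul1 uC] := line_row l1 C; have [w wl2 wC] := line_row l2 C.
have CS : C \notin S.
  by rewrite (disjointFr dis) // !inE Cl1.
have l1S : {in pts l1 :\: pts l2, forall P, (P \in S) = (P \notin N1)}.
  move=> P Pl; have sd : P \in symdiff (pts l1) (pts l2) by rewrite inE Pl.
  have /setP/(_ P) := E; rewrite in_setI in_setD sd andbT in_setU negb_or /= => ->.
  rewrite [P \in N2](contraTF _ Pl) ?andbT // => /(subsetP N2sub).
  by rewrite !inE => /andP[/negPf ->]; rewrite andbF.
have l2S : {in pts l2 :\: pts l1, forall P, (P \in S) = (P \notin N2)}.
  move=> P Pl; have sd : P \in symdiff (pts l1) (pts l2) by rewrite inE Pl orbT.
  have /setP/(_ P) := E; rewrite in_setI in_setD sd andbT in_setU negb_or /= => ->.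
  rewrite [P \in N1](contraTF _ Pl) //= => /(subsetP N1sub).
  by rewrite !inE => /andP[/negPf ->]; rewrite andbF.
have t_ltF : t < #|F| - 1 by rewrite cardF.
(* F has characteristic p, and p divides q but not t. *)
have t_nz : gcdn q t = 1 -> (t%:R != 0 :> F)%R.
  have pF : (p \in [pchar F])%R by apply: card_finPcharP p_prime; rewrite cardF q_def.
  rewrite -(dvdn_pcharf pF) => gcd1; apply: contraTN p_prime => pt.
  have : p %| gcdn q t by rewrite dvdn_gcd pt q_def dvdn_exp.
  by rewrite gcd1 dvdn1 => /eqP ->.
have cop n : gcdn (q - 1) n = 1 -> coprime #|F|.-1 n.
  by rewrite cardF -subn1 => /eqP.
split=> [gcd1 gcd2|/t_nz t0|/cop].
- have X0 := X_eq0 l12 Cl1 Cl2 Cc ul1 uC wl2 wC tangentS CS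
    t_ltF N1sub N2sub N1card N2card l1S l2S (t_nz gcd1).
  (* As X is empty, S equals its trace on the symmetric difference, which is a configuration by
     hypothesis. *)
  have subS := S_sub_symdiff l12 Cl1 Cl2 CS (X0 (cop _ _)).
  exists l1, l2; split=> //; rewrite (setIidPr (subS _)) // in cfg.
  by rewrite -subn1.
- exact: (triangle_of_centroid l12 Cl1 Cl2 Cc ul1 uC wl2 wC tangentS CS
    t_ltF N1sub N2sub N1card N2card l1S l2S t0).
- exact: (cover_of_coprime l12 Cl1 Cl2 Cc ul1 uC wl2 wC tangentS CS
    t_ltF N1sub N2sub N1card N2card l1S l2S).
Qed.
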